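(* Let $f\in\mathbb{R}^q$ and let $W$ be a linear subspace of $\mathbb{R}^q$ such that $f+W$ contains a point of $\mathbb{Z}^q$. Given a maximal lattice-free convex set $B$ of $f+W$ containing $f$ in its interior (relative to $f+W$), the inequality $\sum_{r\in W}\psi_B(r)s_r\ge1$ is a minimal valid inequality for $R_f(W)$.
   Context: $R_f(W)$ is the set of all finitely supported $s=(s_r)_{r\in W}\in\mathbb{R}^W$ such that $s_r\ge 0$ for all $r\in W$ and $f+\sum_{r\in W} r s_r\in\mathbb{Z}^q$. For $\psi:W\to\mathbb{R}$ and $\alpha\in\mathbb{R}$, the inequality $\sum_{r\in W}\psi(r)s_r\ge\alpha$ is valid for $R_f(W)$ if every $s\in R_f(W)$ satisfies it. The inequality $\sum_{r\in W}\psi(r)s_r\ge\alpha$ dominates $\sum_{r\in W}\psi'(r)s_r\ge\alpha$ if $\psi(r)\le\psi'(r)$ for all $r\in W$. A valid inequality $\sum_{r\in W}\psi(r)s_r\ge\alpha$ for $R_f(W)$ is minimal if it is not dominated by any valid inequality $\sum_{r\in W}\psi'(r)s_r\ge\alpha$ for $R_f(W)$ with $\psi'\ne\psi$. A set $B$ is a maximal lattice-free convex set of $f+W$ if $B\subseteq f+W$, $B$ is convex, $B$ has no integral point in its interior with respect to the topology induced on $f+W$ by $\mathbb{R}^q$, and $B$ is inclusionwise maximal with these three properties. Such a $B$ is known to be a polyhedron, and since $f$ is in its interior, there exist $a_1,\dots,a_t\in\mathbb{R}^q$ such that $B=\{x\in f+W : a_i(x-f)\le 1,\ i=1,\dots,t\}$;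 the function $\psi_B:W\to\mathbb{R}$ is defined by $\psi_B(r)=\max_{i=1,\dots,t}a_ir$.
   Formalization: The description of B by a_1,…,a_t that defines ψ_B is required to be irredundant (no inequality can be dropped); with redundant inequalities ψ_B depends on the description and the claim can fail, e.g. when B is a half-line. *)

(* Defs.v *)
From HB Require Import structures.
From mathcomp Require Import all_boot all_order all_algebra.
From mathcomp Require Import all_classical all_reals all_analysis.

Set Implicit Arguments.
Unset Strict Implicit.
Unset Printing Implicit Defensive.

Import Order.TTheory GRing.Theory Num.Theory.
Import numFieldNormedType.Exports.

Local Open Scope classical_set_scope.
Local Open Scope ring_scope.

Definition dot (R : realType) (q : nat) (a x : 'rV[R]_q) : R :=
  (a *m x^T) ord0 ord0.

Definition integral_point (R : realType) (q : nat) (x : 'rV[R]_q) : Prop :=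
  x \is a mxOver Num.int.

Definition translate (R : realType) (q : nat) (f : 'rV[R]_q)
    (W : {vspace 'rV[R]_q}) : set 'rV[R]_q :=
  [set x | x - f \in W].

Definition Rf (R : realType) (q : nat) (f : 'rV[R]_q)
    (W : {vspace 'rV[R]_q}) : set (subvs_of W -> R) :=
  [set s | [/\ finite_set [set r | s r != 0],
               (forall r, 0 <= s r) &
               integral_point (f + \sum_(r \in [set: subvs_of W]) s r *: vsval r)]].

(* psi stands for the inequality sum_r psi(r) s_r >= alpha. *)
Definition valid (R : realType) (q : nat) (f : 'rV[R]_q)
    (W : {vspace 'rV[R]_q}) (psi : subvs_of W -> R) (alpha : R) : Prop :=
  forall s, Rf f s -> alpha <= \sum_(r \in [set: subvs_of W]) psi r * s r.

Definition dominates (R : realType) (q : nat) (W : {vspace 'rV[R]_q})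
    (psi psi' : subvs_of W -> R) : Prop :=
  forall r, psi r <= psi' r.

Definition minimal_valid (R : realType) (q : nat) (f : 'rV[R]_q)
    (W : {vspace 'rV[R]_q}) (psi : subvs_of W -> R) (alpha : R) : Prop :=
  valid f psi alpha /\
  ~ (exists psi' : subvs_of W -> R,
       [/\ valid f psi' alpha, psi' <> psi & dominates psi' psi]).

(* Interior of B in the topology induced on A; meant for B `<=` A (points
   outside A are isolated in [subspace A]). *)
Definition rel_interior (R : realType) (q : nat) (A B : set 'rV[R]_q) :
    set 'rV[R]_q :=
  interior (B : set (subspace A)).

Definition lattice_free_convex (R : realType) (q : nat)
    (A B : set 'rV[R]_q) : Prop :=
  [/\ B `<=` A, convex_set B &
      forall x, rel_interior A B x -> ~ integral_point x].

Definition maximal_lattice_free_convex (R : realType) (q : nat)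
    (A B : set 'rV[R]_q) : Prop :=
  lattice_free_convex A B /\
  forall B' : set 'rV[R]_q,
    lattice_free_convex A B' -> B `<=` B' -> B' = B.

(* B = {x in f + W : a_i (x - f) <= 1 for all i}, where no inequality can be
   dropped.  Irredundancy is what makes max_i a_i r depend on B only: if, e.g.,
   B is a half-space {x in f + W : a (x - f) <= 1}, then adding the redundant
   inequality (a / 2) (x - f) <= 1 changes the maximum wherever a r < 0.
   A set B containing f in its interior and no integral point in its interior
   differs from f + W when f + W contains an integral point, so there is at
   least one inequality. *)
Definition irredundant_description (R : realType) (q : nat) (f : 'rV[R]_q)
    (W : {vspace 'rV[R]_q}) (B : set 'rV[R]_q) (t : nat)
    (a : 'I_t.+1 -> 'rV[R]_q) : Prop :=
  B = [set x | translate f W x /\ forall i, dot (a i) (x - f) <= 1] /\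
  forall i, exists x,
    [/\ translate f W x, (forall j, j != i -> dot (a j) (x - f) <= 1) &
        1 < dot (a i) (x - f)].

(* max_i a_i r; the base value a_0 r is one of the terms, so that the maximum
   may be negative. *)
Definition psi_of (R : realType) (q : nat) (W : {vspace 'rV[R]_q}) (t : nat)
    (a : 'I_t.+1 -> 'rV[R]_q) (r : subvs_of W) : R :=
  \big[Order.max/dot (a ord0) (vsval r)]_(i < t.+1) dot (a i) (vsval r).

(* Main.v *)
(* Let psi be psi_B, let psi' <= psi be valid, and let B' be the set of points
   f + sum_r s_r r with s >= 0 finitely supported and sum_r psi'(r) s_r <= 1.
   B' is convex, contains B, and is lattice-free: an integral point x in its
   interior would leave f + k (x - f) in B' for some k > 1, and scaling the
   corresponding s by 1/k would contradict the validity of psi'.  Hence B' = B.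
   If psi'(r0) < a_i r0 for some i, take y with a_i y = 1 and a_j y <= 1 for the
   other j, which exists by irredundancy.  For small e > 0 the point
   f + (1 - e psi'(r0)) y + e r0 is in B', but a_i takes the value
   1 + e (a_i r0 - psi'(r0)) > 1 there, so it is not in B. *)
Require Import Defs.
From mathcomp Require Import all_boot all_order all_algebra.
From mathcomp Require Import all_classical all_reals all_analysis.
From mathcomp Require Import finmap ring lra.
Set Implicit Arguments.
Unset Strict Implicit.
Import Order.TTheory GRing.Theory Num.Theory.
Import numFieldNormedType.Exports.
Local Open Scope classical_set_scope.
Local Open Scope ring_scope.

(** * Sums weighted by a finitely supported function *)

Section FiniteSupportSums.
Context {R : realType} {T : choiceType} {V : lmodType R}.
Implicit Types (s : T -> R) (F : T -> V).

Lemma fsum_scaleE (A : {fset T}) s F :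
  [set r | s r != 0] `<=` [set` A] ->
  \sum_(r \in [set: T]) s r *: F r = \sum_(r <- A) s r *: F r.
Proof.
move=> sA; apply: fsbigTE => r rA.
case: (eqVneq (s r) 0) => [->|/sA /= rA']; first by rewrite scale0r.
by rewrite rA' in rA.
Qed.

Lemma finite_supp_lin k s s' :
  finite_set [set r | s r != 0] -> finite_set [set r | s' r != 0] ->
  finite_set [set r | k * s r + s' r != 0].
Proof.
move=> fs fs'; apply: (@sub_finite_set _ _ ([set r | s r != 0] `|` [set r | s' r != 0])).
  move=> r /=; case: (eqVneq (s r) 0) => [->|_]; last by left.
  by rewrite mulr0 add0r; right.
by rewrite finite_setU.
Qed.

Lemma fsum_scale_lin k s s' F :
  finite_set [set r | s r != 0] -> finite_set [set r | s' r != 0] ->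
  \sum_(r \in [set: T]) (k * s r + s' r) *: F r =
  k *: (\sum_(r \in [set: T]) s r *: F r) + \sum_(r \in [set: T]) s' r *: F r.
Proof.
move=> fs fs'.
(* One finite set carrying both supports turns all three sums into finite sums over the same index
   set. *)
set A := fset_set ([set r | s r != 0] `|` [set r | s' r != 0]).
have AE : [set` A] = [set r | s r != 0] `|` [set r | s' r != 0].
  by rewrite fset_setK// finite_setU.
rewrite (@fsum_scaleE A s) ?(@fsum_scaleE A s') ?(@fsum_scaleE A); first last.
- by rewrite AE => r; left.
- by rewrite AE => r; right.
- rewrite AE => r /=; case: (eqVneq (s r) 0) => [->|_]; last by left.
  by rewrite mulr0 add0r; right.
rewrite scaler_sumr -big_split/=; apply: eq_bigr => r _.
by rewrite scalerDl scalerA.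
Qed.

Lemma fsum_scale_delta r0 F :
  \sum_(r \in [set: T]) (r == r0)%:R *: F r = F r0 :> V.
Proof.
rewrite (@fsum_scaleE [fset r0]%fset); last first.
  by move=> r /=; rewrite inE; case: (r == r0) => //=; rewrite eqxx.
by rewrite big_seq_fset1 eqxx scale1r.
Qed.

End FiniteSupportSums.

(** Treats the scalars as a module over themselves, so that the vector-valued lemmas also apply to
    the left side of an inequality. *)
Lemma fsum_mul_scale (R : realType) (T : choiceType) (psi s : T -> R) :
  \sum_(r \in [set: T]) psi r * s r =
  \sum_(r \in [set: T]) s r *: (psi r : R^o).
Proof. by apply: eq_fsbigr => r _; rewrite mulrC. Qed.

Lemma fsum_mulE (R : realType) (T : choiceType) (A : {fset T}) (psi s : T -> R) :
  [set r | s r != 0] `<=` [set` A] ->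
  \sum_(r \in [set: T]) psi r * s r = \sum_(r <- A) psi r * s r.
Proof.
move=> sA; apply: fsbigTE => r rA.
case: (eqVneq (s r) 0) => [->|/sA /= rA']; first by rewrite mulr0.
by rewrite rA' in rA.
Qed.

Lemma fsum_mul_lin (R : realType) (T : choiceType) k (s s' psi : T -> R) :
  finite_set [set r | s r != 0] -> finite_set [set r | s' r != 0] ->
  \sum_(r \in [set: T]) psi r * (k * s r + s' r) =
  k * (\sum_(r \in [set: T]) psi r * s r) + \sum_(r \in [set: T]) psi r * s' r.
Proof.
move=> fs fs'; rewrite (fsum_mul_scale psi s) (fsum_mul_scale psi s') fsum_mul_scale.
exact: (@fsum_scale_lin _ _ R^o).
Qed.

Section Dot.
Context {R : realType} {q : nat}.
Implicit Types (a x y : 'rV[R]_q).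

Lemma dotE a x : dot a x = \sum_j a ord0 j * x ord0 j.
Proof. by rewrite /dot mxE; apply: eq_bigr => j _; rewrite mxE. Qed.

Lemma dotD a x y : dot a (x + y) = dot a x + dot a y.
Proof. by rewrite /dot linearD mulmxDr mxE. Qed.

Lemma dotZ a k x : dot a (k *: x) = k * dot a x.
Proof. by rewrite /dot linearZ/= -scalemxAr mxE. Qed.

Lemma dot0 a : dot a 0 = 0.
Proof. by rewrite -(scale0r 0) dotZ mul0r. Qed.

Lemma dot_continuous a : continuous (dot a).
Proof.

have -> : dot a = fun x => \sum_j a ord0 j * x ord0 j by apply/funext => x; exact: dotE.
move=> x; apply: (@cvg_big _ _ _ _ _ add_continuous _ (nbhs x)) => j _.
apply: cvgM; first exact: cvg_cst.
exact: coord_continuous.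
Qed.

Lemma dot_fsum (T : choiceType) (s : T -> R) (F : T -> 'rV[R]_q) a :
  finite_set [set r | s r != 0] ->
  dot a (\sum_(r \in [set: T]) s r *: F r) =
  \sum_(r \in [set: T]) dot a (F r) * s r.
Proof.
move=> fs; have sA : [set r | s r != 0] `<=` [set` fset_set [set r | s r != 0]].
  by rewrite fset_setK.
rewrite (fsum_scaleE _ sA) (fsum_mulE _ sA) (big_morph _ (dotD a) (dot0 a)).
by apply: eq_bigr => r _; rewrite dotZ mulrC.
Qed.

End Dot.

(** * Interior points relative to the affine space [f + W] *)

Section RelativeInterior.
Context {R : realType} {q : nat} (f : 'rV[R]_q) (W : {vspace 'rV[R]_q}).

Lemma rel_interiorE (A B : set 'rV[R]_q) x : A x ->
  rel_interior A B x = \forall y \near x, A y -> B y.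
Proof.
move=> Ax; rewrite /rel_interior /interior/=.
by rewrite [nbhs (x : subspace A)](esym (nbhs_subspace_in Ax)).
Qed.

(** Each strict inequality persists near [x] by continuity, and finitely many of them persist
    together. *)
Lemma rel_interior_polyhedron t (a : 'I_t -> 'rV[R]_q) (B : set 'rV[R]_q) x :
  (forall y, translate f W y -> (forall i, dot (a i) (y - f) <= 1) -> B y) ->
  translate f W x -> (forall i, dot (a i) (x - f) < 1) ->
  rel_interior (translate f W) B x.
Proof.
move=> aB Wx ax; rewrite rel_interiorE//.
have : \forall y \near x, forall i, dot (a i) (y - f) < 1.
  apply: (@filter_forall _ _ (fun i y => dot (a i) (y - f) < 1) (nbhs x)) => i.
  apply: (cvgr_lt (dot (a i) (x - f))) (ax i).
  apply: (@continuous_cvg _ _ _ (nbhs x) _ _ (dot (a i))); first exact: dot_continuous.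
  by apply: cvgB; [exact: cvg_id|exact: cvg_cst].
by apply: filterS => y ay Wy; apply: aB => // i; exact: ltW.
Qed.

(** As [k] tends to 1 from the right, [f + k (x - f)] tends to [x] without leaving [f + W]. *)
Lemma rel_interior_ray (B : set 'rV[R]_q) x :
  translate f W x -> rel_interior (translate f W) B x ->
  exists2 k, 1 < k & B (f + k *: (x - f)).
Proof.
move=> Wx; rewrite rel_interiorE// => Bx.
have c : (fun k : R => f + k *: (x - f)) @ 1^'+ --> x.
  apply: cvg_at_right_filter.
  have -> : nbhs x = nbhs (f + 1 *: (x - f)) by rewrite scale1r addrC subrK.
  by apply: cvgD; [exact: cvg_cst|exact: scalel_continuous].
have [k [k1 kB]] := filter_ex (filterI (nbhs_right_gt 1) (c _ Bx)).
exists k => //; apply: kB.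
by rewrite /translate/= addrAC subrr add0r memvZ.
Qed.

End RelativeInterior.

(** * The cone generated by the graph of [psi] *)

Section Attains.
Context {R : realType} {q : nat} {W : {vspace 'rV[R]_q}}.
Implicit Types (psi : subvs_of W -> R) (v w : 'rV[R]_q).

(* For fixed psi, these pairs (v, c) form the cone generated by the points
   (r, psi r) of the graph of psi. *)
Definition attains psi v (c : R) := exists s : subvs_of W -> R,
  [/\ finite_set [set r | s r != 0], (forall r, 0 <= s r),
      v = \sum_(r \in [set: subvs_of W]) s r *: vsval r &
      c = \sum_(r \in [set: subvs_of W]) psi r * s r].

Lemma attains_val psi r : attains psi (vsval r) (psi r).
Proof.
exists (fun r' => (r' == r)%:R); split=> [|r'||].
- apply: (@sub_finite_set _ _ [set r]) => // r' /=.
  by case: (eqVneq r' r) => //= _; rewrite eqxx.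
- exact: ler0n.
- by rewrite fsum_scale_delta.
- by rewrite fsum_mul_scale fsum_scale_delta.
Qed.

(** Together with [attains0], this single rule gives scaling, sums and convex combinations. *)
Lemma attains_lin psi k v w c d : 0 <= k -> attains psi v c ->
  attains psi w d -> attains psi (k *: v + w) (k * c + d).
Proof.
move=> k0 [s [fs s0 -> ->]] [s' [fs' s'0 -> ->]].
exists (fun r => k * s r + s' r); split.
- exact: finite_supp_lin.
- by move=> r; rewrite addr_ge0// mulr_ge0.
- exact/esym/fsum_scale_lin.
- exact/esym/fsum_mul_lin.
Qed.

Lemma attains0 psi : attains psi 0 0.
Proof.
exists (fun=> 0); split=> //.
- by rewrite (_ : [set _ | _] = set0)//; apply/seteqP; split=> //= r; rewrite eqxx.
- by rewrite fsbig1// => r _; rewrite scale0r.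
- by rewrite fsbig1// => r _; rewrite mulr0.
Qed.

Lemma attains_mem psi v c : attains psi v c -> v \in W.
Proof.
move=> [s [fs _ -> _]].
rewrite (@fsum_scaleE _ _ _ (fset_set [set r | s r != 0])) ?fset_setK//.
by apply: memv_suml => r _; rewrite memvZ// subvsP.
Qed.

Lemma valid_attains f psi v c : valid f psi 1 ->
  attains psi v c -> integral_point (f + v) -> 1 <= c.
Proof. by move=> psi1 [s [fs s0 -> ->]] vf; apply: psi1. Qed.

End Attains.

Lemma valid_sublevel_lattice_free (R : realType) (q : nat) (f : 'rV[R]_q)
    (W : {vspace 'rV[R]_q}) (psi : subvs_of W -> R) :
  valid f psi 1 ->
  lattice_free_convex (translate f W)
    [set x | exists2 c, attains psi (x - f) c & c <= 1].
Proof.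
move=> psi1; split=> [x [c /attains_mem]//|x y l|x xi xZ].
  move=> /set_mem/= [c xc c1] /set_mem/= [d yd d1]; apply/mem_set => /=.
  (* The final 0 is the zero pair that ends two nested uses of [attains_lin]. *)
  exists (l%:num * c + ((1 - l%:num) * d + 0)); last first.
    have l0 : 0 <= l%:num := ge0 l; have l1 : l%:num <= 1 := le1 l.
    rewrite addr0 -[leRHS](addrNK l%:num) addrC lerD//; last by rewrite ler_piMr.
    by rewrite ler_piMr// subr_ge0.
  have -> : conv l x y - f =
      l%:num *: (x - f) + ((1 - l%:num) *: (y - f) + 0) :> 'rV[R]_q.
    by rewrite addr0 !scalerBr addrACA -opprD -scalerDl [l%:num + _]addrC subrK scale1r.
  apply: attains_lin => //; apply: attains_lin => //.
  exact: attains0.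
have [_ /attains_mem xW _] := nbhs_singleton xi.
have [k k1 [c]] := rel_interior_ray xW xi.
rewrite [f + _]addrC addrK => xc c1.
have k0 : 0 < k by exact: lt_trans k1.
(* Scaling by [1/k] turns the pair for [k (x - f)] into [(x - f, c/k)]. Validity at the integral
   point [x] gives [1 <= c/k], against [c <= 1 < k]. *)
have := attains_lin (_ : 0 <= k^-1) xc (attains0 psi).
rewrite invr_ge0 ltW// => /(_ isT).
rewrite scalerA mulVf ?gt_eqF// scale1r !addr0 => /(valid_attains psi1).
rewrite addrC subrK => /(_ xZ).
rewrite ler_pdivlMl// mulr1 => kc.
by have := lt_le_trans k1 (le_trans kc c1); rewrite ltxx.
Qed.

Theorem lemma31 (R : realType) (q : nat) (f : 'rV[R]_q)
    (W : {vspace 'rV[R]_q})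
    (hW : exists x : 'rV[R]_q, translate f W x /\ integral_point x)
    (B : set 'rV[R]_q)
    (hB : maximal_lattice_free_convex (translate f W) B)
    (hf : rel_interior (translate f W) B f)
    (t : nat) (a : 'I_t.+1 -> 'rV[R]_q)
    (ha : irredundant_description f W B a) :
  minimal_valid f (psi_of (W := W) a) 1.
Proof.
case: hB => -[BW _ Bfree] Bmax; case: ha => BE irr.
have dot_psi i r : dot (a i) (vsval r) <= psi_of a r.
  exact: (@le_bigmax _ _ _ _ (fun i => dot (a i) (vsval r))).
split=> [s [fs s0 sZ]|[psi' [psi'1 psi'N psi'le]]].
  set v := \sum_(r \in _) s r *: vsval r in sZ.
  have vW : v \in W by apply: (@attains_mem _ _ _ (psi_of a)); exists s.
  have Wfv : translate f W (f + v) by rewrite /translate/= addrC addKr.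
  (* Otherwise [f + v] would be an integral point in the interior of [B]. *)
  have [i ai] : exists i, 1 <= dot (a i) v.
    apply: contrapT => /forallNP ai; apply: (Bfree (f + v)) => //.
    apply: (@rel_interior_polyhedron _ _ _ _ _ a) => // [y Wy ay|i].
      by rewrite BE.
    by rewrite addrC addKr ltNge; apply/negP/ai.
  (* By linearity [dot (a i) v] is a sum with weights [s r >= 0], so the bound [dot_psi] applies
     term by term. *)
  apply: le_trans ai _; rewrite /v dot_fsum//.
  rewrite !(@fsum_mulE _ _ (fset_set [set r | s r != 0])) ?fset_setK//.
  by apply: ler_sum => r _; exact: ler_wpM2r.
have [r0 r0lt] : exists r, psi' r < psi_of a r.
  apply: contrapT => /forallNP psi'ge; apply: psi'N; apply/funext => r.
  by apply/eqP; rewrite eq_le psi'le leNgt; apply/negP/psi'ge.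
have [i air0] : exists i, psi' r0 < dot (a i) (vsval r0).
  apply: contrapT => /forallNP ar0; move: r0lt; rewrite ltNge => /negP; apply.
  by apply: bigmax_le => [|i _]; rewrite leNgt; exact/negP/ar0.
have [x [Wx aj ai]] := irr i.
(* Shrinking [x - f] by this factor makes inequality [i] tight. The others survive because
   [0 < l < 1] and their right side is positive. *)
set l := (dot (a i) (x - f))^-1.
have l0 : 0 < l by rewrite invr_gt0 (lt_trans _ ai).
have l1 : l < 1 by rewrite invf_lt1// (lt_trans _ ai).
have [y yE] : exists y : subvs_of W, vsval y = l *: (x - f).
  by exists (vsproj W (l *: (x - f))); rewrite vsprojK// memvZ.
have aiy : dot (a i) (vsval y) = 1 by rewrite yE dotZ mulVf// gt_eqF// (lt_trans _ ai).
have psiy : psi_of a y <= 1.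
  have ajy j : dot (a j) (vsval y) <= 1.
    have [->|ji] := eqVneq j i; first by rewrite aiy.
    rewrite yE dotZ; have := aj j ji; nra.
  by apply: bigmax_le.
set B' := [set x | exists2 c, attains psi' (x - f) c & c <= 1].
have B'B : B' = B.
  apply: Bmax; first exact: valid_sublevel_lattice_free.
  (* A point [z] of [B] needs only the generator [z - f], whose cost satisfies
     [psi' <= psi <= 1]. *)
  move=> z Bz; have := Bz; rewrite BE => -[Wz az].
  have [z' z'E] : exists z' : subvs_of W, vsval z' = z - f.
    by exists (vsproj W (z - f)); rewrite vsprojK.
  exists (psi' z'); first by rewrite -z'E; exact: attains_val.
  by apply: le_trans (psi'le z') _; apply: bigmax_le; rewrite z'E.
have [e e0 e1] : exists2 e, 0 < e & 0 <= 1 - e * psi' r0.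
  (* This choice gives [e * psi' r0 <= 1] whatever the sign of [psi' r0], so the weight of [y] is
     nonnegative. *)
  exists (1 + `|psi' r0|)^-1; first by rewrite invr_gt0 ltr_wpDr.
  rewrite subr_ge0 mulrC ler_pdivrMr ?ltr_wpDr// mul1r.
  by rewrite (le_trans (ler_norm _))// lerDr.
have : B' (f + ((1 - e * psi' r0) *: vsval y + (e *: vsval r0 + 0))).
  exists ((1 - e * psi' r0) * psi' y + (e * psi' r0 + 0)).
    rewrite addrC addKr; apply: attains_lin => //; first exact: attains_val.
    by apply: attains_lin; [exact: ltW|exact: attains_val|exact: attains0].
  (* Since [psi' y <= psi y <= 1], the cost is at most [(1 - e psi' r0) + e psi' r0 = 1]. *)
  have := psi'le y; nra.
rewrite B'B BE => -[_ /(_ i)].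
rewrite addrC addKr !dotD !dotZ dot0 aiy; nra.
Qed.
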